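(* Let $X$ be a Banach space and let $x\in S_X$ be a super Daugavet point. Then, for every $\varepsilon>0$ and every non-empty relatively weakly open subset $W$ of $B_X$, there exists $y\in W$ such that $\|x+\theta y\|>2-\varepsilon$ for every $\theta\in\mathbb{T}$.
   Context: Banach spaces are over $\mathbb{K}$ ($\mathbb{R}$ or $\mathbb{C}$); $B_X$, $S_X$ denote the closed unit ball and the unit sphere of $X$; $\mathbb{T}=\{\theta\in\mathbb{K}:|\theta|=1\}$. A point $x\in S_X$ is a super Daugavet point if $\sup_{y\in W}\|x+y\|=2$ for every non-empty relatively weakly open subset $W$ of $B_X$. *)

(* Defs.v *)
From HB Require Import structures.
From mathcomp Require Import all_boot all_order all_algebra.
From mathcomp Require Import complex.
From mathcomp Require Import all_classical all_reals all_analysis.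

Set Implicit Arguments.
Unset Strict Implicit.
Unset Printing Implicit Defensive.

Import Order.TTheory GRing.Theory Num.Theory.
Import numFieldNormedType.Exports.

Local Open Scope classical_set_scope.
Local Open Scope ring_scope.

(* Norms of an [X : normedModType K] take values in [K] itself.  For [K = R[i]]
   the order is partial ([z <= w] iff ['Im z = 'Im w] and ['Re z <= 'Re w]), so
   that [0 < e] entails that [e] is real. *)
Variant real_or_complex : numFieldType -> Prop :=
  | RealScalars (R : realType) : real_or_complex R
  | ComplexScalars (R : realType) : real_or_complex R[i].

Section SuperDaugavet.
Variables (K : numFieldType) (X : normedModType K).

Definition unit_ball : set X := [set y | `|y| <= 1].

Definition unit_sphere : set X := [set y | `|y| = 1].

Definition dual : Type := {f : {linear X -> K^o} | continuous f}.

Definition weak_topology : topologicalType :=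
  sup_topology (fun f : dual =>
    Topological.on (initial_topology (sval f : X -> K^o))).

Definition weakly_open (U : set X) : Prop := @open weak_topology U.

Definition relatively_weakly_open_in_ball (W : set X) : Prop :=
  exists2 U, weakly_open U & W = U `&` unit_ball.

(* Upper bounds in [R[i]] of a nonempty set of norms are real, so [isLub] is the
   supremum in the reals also for complex scalars. *)
Definition super_daugavet_point (x : X) : Prop :=
  unit_sphere x /\
  forall W : set X, relatively_weakly_open_in_ball W -> W !=set0 ->
    isLub [set `|x + y| | y in W] (2 : K).

End SuperDaugavet.

(* Main.v *)
Require Import Defs.
From HB Require Import structures.
From mathcomp Require Import all_boot all_order all_algebra.
From mathcomp Require Import complex.
From mathcomp Require Import all_classical all_reals all_analysis.
From mathcomp Require Import ring lra.

Set Implicit Arguments.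
Unset Strict Implicit.
Unset Printing Implicit Defensive.

Import Order.TTheory GRing.Theory Num.Theory.
Import numFieldNormedType.Exports.

Local Open Scope classical_set_scope.
Local Open Scope ring_scope.

(** By Hahn-Banach the norm is the maximum of the moduli of contractive functionals,
    so [{y | c < |x + y|}] is weakly open.  Scaling by [t], [|t| = 1], preserves
    relatively weakly open subsets of the ball; hence the super Daugavet property
    applied to [t W] shrinks [W] to a nonempty relatively weakly open subset on
    which [|x + t y| > 2 - e].  Iterating over a finite net of the unit circle
    handles all [t] up to a small error.

    Hahn-Banach is obtained without extending functionals from subspaces: a
    minimal sublinear functional is odd, hence linear. *)

(** * Sublinear functionals and the Hahn-Banach theorem over the reals *)

Section Sublinear.
Context {R : realType} {V : lmodType R}.
Implicit Types (p q : V -> R) (u v w : V).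

Definition sublinear p :=
  (forall u v, p (u + v) <= p u + p v) /\
  (forall (a : R) v, 0 < a -> p (a *: v) = a * p v).

Lemma sublinear0 p : sublinear p -> p 0 = 0.
Proof.
move=> [_ /(_ 2 0)]; rewrite scaler0 ltr0n => /(_ isT).
by rewrite mulr_natl mulr2n -{1}[p 0]addr0 => /addrI.
Qed.

Lemma sublinearZ p a v : sublinear p -> 0 <= a -> p (a *: v) = a * p v.
Proof.
move=> sp; rewrite le_eqVlt => /predU1P[<-|]; last exact: sp.2.
by rewrite scale0r mul0r sublinear0.
Qed.

Lemma sublinear_geN p v : sublinear p -> - p (- v) <= p v.
Proof. by move=> sp; rewrite -subr_ge0 opprK -(sublinear0 sp) -(subrr v) sp.1. Qed.

(** The bound [b] keeps every infimum finite. Subadditivity is asked only up to some [t <= r + s],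
    which covers both the values along a ray and the values of a chain of functionals. *)
Lemma sublinear_inf (S : V -> set R) (b : V -> R) :
  (forall v, S v !=set0) -> (forall v, lbound (S v) (b v)) ->
  (forall u v r s, S u r -> S v s -> exists2 t, S (u + v) t & t <= r + s) ->
  (forall a v r, 0 < a -> S v r -> S (a *: v) (a * r)) ->
  sublinear (fun v => inf (S v)).
Proof.
move=> S0 Sb SD SZ.
have inf_le v r : S v r -> inf (S v) <= r.
  by move=> Svr; apply: ge_inf => //; exists (b v).
split=> [u v|a v a0].
  rewrite -lerBlDr; apply: lb_le_inf => // r Sur.
  rewrite lerBlDr -lerBlDl; apply: lb_le_inf => // s Svs.
  rewrite lerBlDl; have [t St] := SD _ _ _ _ Sur Svs.
  by apply: le_trans; exact: inf_le.
have Zle c w : 0 < c -> inf (S (c *: w)) <= c * inf (S w).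
  move=> c0; rewrite -ler_pdivrMl//; apply: lb_le_inf => // r Swr.
  by rewrite ler_pdivrMl//; apply/inf_le/SZ.
apply/eqP; rewrite eq_le Zle//= -ler_pdivlMl//.
by rewrite -[in leLHS](scalerK (lt0r_neq0 a0) v) Zle ?invr_gt0.
Qed.

(* [q] is [v |-> inf_(t >= 0) (p (v + t w) - t p w)]. *)
Lemma sublinear_shrink p w : sublinear p ->
  exists q, [/\ sublinear q, forall v, q v <= p v & q (- w) <= - p w].
Proof.
move=> sp.
pose S v := [set p (v + t *: w) - t * p w | t in [set t : R | 0 <= t]].
(* Since [t *: w] is the sum of [v + t *: w] and [- v], subadditivity gives
   [t * p w <= p (v + t *: w) + p (- v)]. *)
have Slb v : lbound (S v) (- p (- v)).
  move=> _ [t /= t0 <-]; rewrite -(sublinearZ _ sp t0) lerBrDr.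
  by rewrite [leLHS]addrC lerBlDr (le_trans _ (sp.1 _ _))// addrAC subrr add0r.
have inf_le v r : S v r -> inf (S v) <= r.
  by move=> Svr; apply: ge_inf => //; exists (- p (- v)).
exists (fun v => inf (S v)); split.
- apply: (sublinear_inf (b := fun v => - p (- v))) => //.
  + by move=> v; exists (p (v + 0 *: w) - 0 * p w); exists 0 => /=.
  + move=> u v _ _ [s /= s0 <-] [t /= t0 <-].
    exists (p (u + v + (s + t) *: w) - (s + t) * p w).
      by exists (s + t) => //=; exact: addr_ge0.
    rewrite addrACA -opprD -mulrDl lerD2r scalerDl addrACA; exact: sp.1.
  + move=> a v _ a0 [t /= t0 <-]; exists (a * t) => /=.
      by rewrite mulr_ge0// ltW.
    by rewrite -scalerA -scalerDr sp.2// -mulrA mulrBr.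
- by move=> v; apply: inf_le; exists 0 => //=; rewrite scale0r mul0r addr0 subr0.
- apply: inf_le; exists 1 => //=.
  by rewrite scale1r mul1r addNr (sublinear0 sp) sub0r.
Qed.

(** Zorn's lemma on the sublinear functionals below [p]: a nonempty chain is bounded below by its
    pointwise infimum, which is finite because each member is at least [- p (- v)] at [v]. *)
Lemma sublinear_minimal p : sublinear p ->
  exists q, [/\ sublinear q, forall v, q v <= p v &
    forall r, sublinear r -> (forall v, r v <= q v) -> forall v, q v <= r v].
Proof.
move=> sp.
pose T := {q : V -> R | sublinear q /\ forall v, q v <= p v}.
(* The order is reversed, so that a maximal element is a minimal functional. *)
pose ge_fun (q r : T) := `[< forall v, sval r v <= sval q v >].
pose p' : T := exist _ p (conj sp (fun v => lexx (p v))).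
have [| |A totA|q qmax] := ZL_preorder p' (R := ge_fun).
- by move=> q; apply/asboolP.
- move=> q r s /asboolP qr /asboolP rs; apply/asboolP => v.
  exact: le_trans (rs v) (qr v).
- have [[q0 Aq0]|A0] := pselect (A !=set0); last first.
    by exists p' => q Aq; exfalso; apply: A0; exists q.
  pose S v := [set sval q v | q in A].
  have Slb v : lbound (S v) (- p (- v)).
    move=> _ [q _ <-]; case: q => q [sq qp] /=.
    by rewrite (le_trans _ (sublinear_geN v sq))// lerN2.
  have inf_le v (q : T) : A q -> inf (S v) <= sval q v.
    by move=> Aq; apply: ge_inf; [exists (- p (- v))|exists q].
  have sS : sublinear (fun v => inf (S v)).
    apply: (sublinear_inf (b := fun v => - p (- v))) => //.
    + by move=> v; exists (sval q0 v); exists q0.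
    + move=> u v _ _ [q Aq <-] [r Ar <-].
      have [/asboolP qr|/asboolP rq] := totA _ _ Aq Ar.
      * exists (sval r (u + v)); first by exists r.
        by rewrite (le_trans ((svalP r).1.1 _ _))// lerD2r.
      * exists (sval q (u + v)); first by exists q.
        by rewrite (le_trans ((svalP q).1.1 _ _))// lerD2l.
    + move=> a v _ a0 [q Aq <-]; exists q => //; exact: (svalP q).1.2.
  have Sp v : inf (S v) <= p v.
    exact: le_trans (inf_le v q0 Aq0) ((svalP q0).2 v).
  pose m : T := exist _ (fun v => inf (S v)) (conj sS Sp).
  exists m => q Aq; apply/asboolP => v /=.
  exact: inf_le.
case: q qmax => q [sq qp] qmax; exists q; split=> // r sr rq.
have rp v : r v <= p v by exact: le_trans (rq v) (qp v).
pose r' : T := exist _ r (conj sr rp).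
by have /asboolP := qmax r' (introT (asboolP _) rq); exact.
Qed.

Theorem hahn_banach_support p w : sublinear p ->
  exists2 f : {scalar V}, forall v, f v <= p v & f w = p w.
Proof.
(* Shrinking at [w] before minimizing forces [f (- w) <= - p w] for every [f] below [q0]; once [f]
   is odd, this yields [f w = p w]. *)
move=> sp; have [q0 [sq0 q0p q0w]] := sublinear_shrink w sp.
have [f [sf fq0 fmin]] := sublinear_minimal sq0.
have fN v : f (- v) = - f v.
  (* By minimality the shrunken [q] still dominates [f], so [f (- v) <= q (- v) <= - f v]. *)
  have [q [sq qf qv]] := sublinear_shrink v sf.
  apply/eqP; rewrite eq_le (le_trans (fmin _ sq qf _) qv)/=.
  by rewrite lerNl sublinear_geN.
have fD u v : f (u + v) = f u + f v.
  apply/eqP; rewrite eq_le sf.1/= -lerN2 opprD -!fN opprD; exact: sf.1.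
have fp v : f v <= p v := le_trans (fq0 v) (q0p v).
have f_lin : scalar f.
  move=> a u v; rewrite fD; congr (_ + _).
  have [a0|/ltW a0] := leP 0 a; first exact: (sublinearZ _ sf).
  by rewrite -[a]opprK scaleNr fN (sublinearZ _ sf) ?oppr_ge0// -mulNr.
pose F : {scalar V} := HB.pack f (GRing.isLinear.Build R V R *%R f f_lin).
exists F => //=.
by apply/eqP; rewrite eq_le fp/= -lerN2 -fN (le_trans (fq0 _)).
Qed.

End Sublinear.

(** * Norming functionals over real and complex scalars *)

Lemma dual_of_contraction (K : numFieldType) (X : normedModType K)
    (f : X -> K) : scalar f -> (forall v, `|f v| <= `|v|) ->
  exists g : dual X, sval g =1 f.
Proof.
move=> f_lin f_le.
pose F : {linear X -> K^o} :=
  HB.pack f (GRing.isLinear.Build K X K^o *:%R f f_lin).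
have F_cont : continuous F.
  apply/bounded_linear_continuous/linear_boundedP; near=> r => v.
  by rewrite (le_trans (f_le v))// ler_peMl//; near: r; exact: nbhs_pinfty_ge.
by exists (exist _ F F_cont).
Unshelve. all: by end_near. Qed.

(** A separate name for the carrier, to hold the real scalar action alongside the complex one. *)
Definition realification (R : realType) (X : lmodType R[i]) : Type := X.

Section Realification.
Context {R : realType} {X : lmodType R[i]}.
Local Notation XR := (realification X).

HB.instance Definition _ := GRing.Zmodule.on XR.

Let scaleR (a : R) (v : XR) : XR := (a%:C)%C *: (v : X).

Let scaleRA a b v : scaleR a (scaleR b v) = scaleR (a * b) v.
Proof. by rewrite /scaleR scalerA -rmorphM. Qed.

Let scaleR1 : left_id 1 scaleR.
Proof. by move=> v; rewrite /scaleR rmorph1 scale1r. Qed.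

Let scaleRDr : right_distributive scaleR +%R.
Proof. by move=> a u v; rewrite /scaleR scalerDr. Qed.

Let scaleRDl v : {morph scaleR^~ v : a b / a + b}.
Proof. by move=> a b; rewrite /scaleR rmorphD scalerDl. Qed.

HB.instance Definition _ :=
  GRing.Zmodule_isLmodule.Build R XR scaleRA scaleR1 scaleRDr scaleRDl.

Lemma realification_scaleE (a : R) (v : XR) : a *: v = (a%:C)%C *: (v : X).
Proof. by []. Qed.

End Realification.

Section Complexification.
Local Open Scope complex_scope.
Context {R : realType} {X : lmodType R[i]}.
Context (f : {scalar realification X}).

(* The complex-linear functional with real part [f]. *)
Definition complexified (v : X) : R[i] := f v -i* f ('i *: v).

Let fD (u v : X) : f (u + v) = f u + f v.
Proof. exact: (linearD f). Qed.

Let fZ (a : R) (v : X) : f (a%:C *: v) = a * f v.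
Proof. exact: (linearZ_LR f). Qed.

Let complexified_scalar : scalar complexified.
Proof.
have fN (v : X) : f (- v) = - f v := linearN f v.
move=> [a b] u v; rewrite /complexified.
have -> : (a +i* b) *: u = a%:C *: u + b%:C *: ('i *: u).
  rewrite scalerA -scalerDl [b%:C * _]mulrC; congr (_ *: u).
    exact: complexE (a +i* b).
have -> : 'i *: (a%:C *: u + b%:C *: ('i *: u) + v) =
    a%:C *: ('i *: u) - b%:C *: u + 'i *: v.
  rewrite !scalerDr !scalerA ['i * a%:C]mulrC mulrAC -expr2 sqr_i mulN1r.
  by rewrite scaleNr.
by rewrite !fD fN !fZ; apply/eqP; rewrite eq_complex /=;
  apply/andP; split; apply/eqP; ring.
Qed.

HB.instance Definition _ :=
  GRing.isLinear.Build R[i] X R[i] *%R complexified complexified_scalar.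

End Complexification.

Lemma norming_functional (K : numFieldType) (X : normedModType K) (w : X) :
  real_or_complex K ->
  exists2 f : dual X, `|sval f w| = `|w| & forall v, `|sval f v| <= `|v|.
Proof.
move=> hK; case: hK X w => R X w.
  have norm_sub : sublinear (fun v : X => `|v|).
    by split=> [|a v a0]; [exact: ler_normD|rewrite normrZ gtr0_norm].
  have [f f_le fw] := hahn_banach_support w norm_sub.
  have f_norm v : `|f v| <= `|v|.
    by rewrite ler_norml f_le andbT lerNl -raddfN -(normrN v) f_le.
  have [g gE] := dual_of_contraction (linearP f) f_norm.
  by exists g => [|v]; rewrite gE// fw normr_id.
pose p (v : realification X) : R := complex.Re `|v : X|.
have normE (v : X) : `|v| = (p v)%:C%C.
  by rewrite RRe_real// ger0_real.
have p_sub : sublinear p.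
  split=> [u v|a v a0].
    by rewrite -lecR rmorphD /= -!normE ler_normD.
  apply/complexI; rewrite rmorphM /= -!normE realification_scaleE normrZ.
  by rewrite ger0_norm// ler0c ltW.
have [f f_le fw] := hahn_banach_support (w : realification X) p_sub.
pose g : {scalar X} := complexified f.
have g_le v : `|g v| <= `|v|.
  have [->|gv0] := eqVneq (g v) 0; first by rewrite normr0.
  (* Rotating [v] by the unimodular [t] makes [g] real and nonnegative there, so it agrees with its
     real part [f], which is bounded by the norm. *)
  pose t := `|g v| / g v.
  have t1 : `|t| = 1 by rewrite normrM normr_id normfV divff ?normr_eq0.
  have gtv : g (t *: v) = `|g v| by rewrite linearZ /= divfK.
  have -> : `|g v| = (f (t *: v))%:C%C.
    by rewrite -(RRe_real (normr_real (g v))) -gtv.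
  by rewrite -[leRHS]mul1r -t1 -normrZ normE lecR.
have [h hE] := dual_of_contraction (linearP g) g_le.
exists h => [|v]; rewrite hE//; apply/eqP; rewrite eq_le g_le/= normE -fw.
by rewrite (le_trans _ (normc_ge_Re _))// lecR ler_norm.
Qed.

(** * Weakly open sets and relatively weakly open subsets of the ball *)

Section WeakTopology.
Context {K : numFieldType} {X : normedModType K}.
Local Notation Xw := (weak_topology X).

Lemma dual_weakly_continuous (f : dual X) :
  continuous (sval f : Xw -> K^o).
Proof.
move=> y; have /cvg_sup/(_ f) yf : nbhs (y : Xw) --> (y : Xw) by [].
apply: cvg_trans (@initial_continuous X K^o (sval f) y).
by move=> A /yf.
Qed.

Lemma scaler_weakly_continuous (t : K) : continuous ( *:%R t : Xw -> Xw).
Proof.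
move=> y; have FF : Filter (nbhs (y : Xw)) := @nbhs_filter Xw y.
apply/cvg_sup => f A [_ [[B oB <-] /= Bty BA]].
apply: (@filterS _ _ (fmap_filter _ FF) _ _ BA).
have tf_cont : continuous (fun z : Xw => sval f (t *: z) : K).
  rewrite (_ : (fun _ => _) = fun z => t * sval f z) => [z|]; last first.
    by apply/funext => z; exact: linearZ_LR.
  by apply: continuousM; [exact: cst_continuous|exact: dual_weakly_continuous].
by apply: tf_cont; exact: open_nbhs_nbhs.
Qed.

Lemma weakly_open_scale (t : K) (U : set X) :
  weakly_open U -> weakly_open ( *:%R t @^-1` U).
Proof.
by apply: (@open_comp Xw Xw) => // y _; exact: scaler_weakly_continuous.
Qed.

Lemma open_norm_gt (c : K) : open [set z : K | c < `|z|].
Proof.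
rewrite openE => z /= cz; apply/nbhs_ballP; exists (`|z| - c) => /=.
  by rewrite subr_gt0.
move=> u; rewrite /ball/= ltrBrDl -ltrBrDr => /lt_le_trans; apply.
by rewrite lerBlDr -lerBlDl lerB_dist.
Qed.

Lemma weakly_open_norm_gt (hK : real_or_complex K) (c : K) (x : X) :
  weakly_open [set y : X | c < `|x + y|].
Proof.
rewrite /weakly_open openE => y /= cxy.
(* With [f] norming [x + y], the condition [c < |f (x + z)|] defines a weak neighbourhood of [y],
   and it implies [c < |x + z|] because [f] is contractive. *)
have [f fxy f_le] := norming_functional (x + y) hK.
have f_cont : {for y, continuous (fun z : Xw => sval f x + sval f z : K)}.
  by apply: continuousD; [exact: cst_continuous|exact: dual_weakly_continuous].
have : nbhs (sval f x + sval f y : K) [set z : K | c < `|z|].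
  apply: open_nbhs_nbhs; split; first exact: open_norm_gt.
  by rewrite /= -linearD fxy.
move=> /f_cont; apply: (@filterS _ _ (@nbhs_filter Xw y)) => z /=.
by rewrite -linearD => /lt_le_trans; apply.
Qed.

Lemma relatively_weakly_openI (W U : set X) :
  relatively_weakly_open_in_ball W -> weakly_open U ->
  relatively_weakly_open_in_ball (W `&` U).
Proof.
move=> [V oV ->] oU; exists (V `&` U); first exact: openI.
by rewrite setIAC.
Qed.

Lemma relatively_weakly_open_scale (t : K) (W : set X) : `|t| = 1 ->
  relatively_weakly_open_in_ball W ->
  relatively_weakly_open_in_ball ( *:%R t @^-1` W).
Proof.
move=> t1 [U oU ->]; exists ( *:%R t @^-1` U); first exact: weakly_open_scale.
by apply/seteqP; split=> y [] /=; rewrite /unit_ball /= normrZ t1 mul1r.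
Qed.

End WeakTopology.

(** * The super Daugavet property for finitely many rotations *)

Lemma super_daugavet_norm_gt (K : numFieldType) (X : normedModType K) (x : X)
    (W : set X) (e : K) : super_daugavet_point x ->
  relatively_weakly_open_in_ball W -> W !=set0 -> 0 < e ->
  exists2 y, W y & 2 - e < `|x + y|.
Proof.
move=> [_ xD] oW W0 e0; apply: contrapT => noy.
have [_ /(_ (2 - e)) le2] := xD W oW W0.
have : 2 <= 2 - e :> K.
  (* Both sides are real, so negating the strict inequality is legitimate although the order of [K]
     may be partial. *)
  apply: le2 => _ [y Wy <-]; rewrite real_leNgt ?normr_real//.
    by apply/negP => xy; apply: noy; exists y.
  by rewrite rpredB ?gtr0_real// ltr0n.
by rewrite -subr_ge0 addrAC subrr sub0r oppr_ge0 lt_geF.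
Qed.

Lemma super_daugavet_norm_gt_seq (K : numFieldType) (X : normedModType K)
    (x : X) (e : K) (s : seq K) : real_or_complex K ->
  super_daugavet_point x -> 0 < e -> (forall t, t \in s -> `|t| = 1) ->
  forall W : set X, relatively_weakly_open_in_ball W -> W !=set0 ->
  exists2 y, W y & forall t, t \in s -> 2 - e < `|x + t *: y|.
Proof.
move=> hK xD e0; elim: s => [|t s IHs] s1 W oW W0.
  by have [y Wy] := W0; exists y.
have t1 : `|t| = 1 by apply: s1; rewrite mem_head.
have t0 : t != 0 by rewrite -normr_eq0 t1 oner_neq0.
pose U := *:%R t @^-1` [set y | 2 - e < `|x + y|].
have oU : weakly_open U by apply/weakly_open_scale/weakly_open_norm_gt.
have [|||y [Wy Uy] ys] := IHs _ (W `&` U).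
- by move=> u us; apply: s1; rewrite in_cons us orbT.
- exact: relatively_weakly_openI.
(* The preimage of [W] under [t^-1] is [t W]; a point [z] of it with [|x + z|] large gives the point
   [t^-1 *: z] of [W] and [U]. *)
- have [|||z Wz xz] := @super_daugavet_norm_gt _ _ x ( *:%R t^-1 @^-1` W) e xD.
  + by apply: relatively_weakly_open_scale; rewrite // normfV t1 invr1.
  + by have [z Wz] := W0; exists (t *: z) => /=; rewrite scalerK.
  + by [].
  + by exists (t^-1 *: z); split => //=; rewrite /U /= scalerKV.
- exists y => // u; rewrite in_cons => /predU1P[->//|]; exact: ys.
Qed.

(** * Finite nets of the unit circle, and the passage to all rotations *)

Lemma unit_circle_net (K : numFieldType) (d : K) : real_or_complex K -> 0 < d ->
  exists2 s : seq K, forall t, t \in s -> `|t| = 1 &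
    forall t, `|t| = 1 -> exists2 u, u \in s & `|t - u| < d.
Proof.
move=> hK; case: hK d => R d d0.
  exists [:: 1; -1] => [t|t t1].
    by rewrite !inE => /orP[/eqP->|/eqP->]; rewrite ?normrN normr1.
  exists t; last by rewrite subrr normr0.
  have := t1; rewrite !inE; have [_ ->|_ <-] := ger0P t; rewrite ?eqxx//.
  by rewrite opprK eqxx orbT.
have [r r0 dE] : exists2 r : R, 0 < r & d = (r%:C)%C.
  exists (complex.Re d); last by rewrite RRe_real// gtr0_real.
  by move: d0; rewrite ltcE => /andP[].
pose n := (Num.truncn (2 / r)).+1.
have n0 : 0 < n%:R :> R by rewrite ltr0n.
have nr : 2 / n%:R < r.
  by rewrite ltr_pdivrMr// mulrC -ltr_pdivrMr// /n truncnS_gt.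
(* Cells of length [1 / n] partition [[-1, 1]]. The endpoint [1] has index [2 * n], hence
   [2 * n + 1] cells. *)
pose cell (a : R) : 'I_(2 * n).+1 := inord (Num.truncn ((a + 1) * n%:R)).
have cellP a b : `|a| <= 1 -> `|b| <= 1 -> cell a = cell b ->
    (a - b) ^+ 2 < n%:R^-1 ^+ 2.
  have ge0 (c : R) : `|c| <= 1 -> 0 <= (c + 1) * n%:R.
    rewrite ler_norml => /andP[c1 _].
    by rewrite mulr_ge0 ?(ltW n0)// -lerBlDr sub0r.
  have lt2n (c : R) : `|c| <= 1 -> (Num.truncn ((c + 1) * n%:R) < (2 * n).+1)%N.
    move=> c1; rewrite ltnS -(ler_nat R).
    have /andP[/le_trans-> //] := truncn_itv (ge0 _ c1).
    rewrite natrM ler_pM2r// -[leRHS]/(1 + 1) lerD2r.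
    exact: le_trans (ler_norm c) c1.
  move=> a1 b1 /(congr1 val); rewrite /= !inordK ?lt2n// => ab.
  have /andP[ma aM] := truncn_itv (ge0 _ a1).
  have /andP[mb bM] := truncn_itv (ge0 _ b1).
  rewrite -real_normK ?num_real// ltr_pXn2r// ?nnegrE ?invr_ge0 ?(ltW n0)//.
  rewrite -[ltRHS]mul1r ltr_pdivlMr// -[X in _ * X]gtr0_norm// -normrM.
  rewrite ltr_norml; move: ma aM mb bM; rewrite ab -natr1 => ma aM mb bM.
  by apply/andP; split; lra.
pose P (c : 'I_(2 * n).+1 * 'I_(2 * n).+1) : set R[i] :=
  [set t | `|t| = 1 /\ (cell (complex.Re t), cell (complex.Im t)) = c].
(* One point of the circle per cell of the square; the default [1] for cells missing the circle
   keeps every representative unimodular. *)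
pose rep c := xget 1 (P c).
have rep1 c : `|rep c| = 1.
  by rewrite /rep; case: xgetP => [t _ []//|_]; rewrite normr1.
exists [seq rep c | c : 'I_(2 * n).+1 * 'I_(2 * n).+1].
  by move=> _ /mapP[c _ ->].
move=> t t1; pose c := (cell (complex.Re t), cell (complex.Im t)).
exists (rep c); first by apply: map_f; rewrite mem_enum.
have [_ [cRe cIm]] : P c (rep c) by apply: (xgetI 1 (x := t)).
have Re_le1 (z : R[i]) : `|z| = 1 -> `|complex.Re z| <= 1.
  by move=> z1; rewrite -lecR rmorph1 -z1 normc_ge_Re.
have Im_le1 (z : R[i]) : `|z| = 1 -> `|complex.Im z| <= 1.
  move=> z1; rewrite -normrN -ReiNIm Re_le1// normrM z1 mul1r normc_def /=.
  by rewrite expr0n expr1n add0r sqrtr1.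
have tRe := cellP _ _ (Re_le1 _ (rep1 c)) (Re_le1 _ t1) cRe.
have tIm := cellP _ _ (Im_le1 _ (rep1 c)) (Im_le1 _ t1) cIm.
(* The squared distance is below [2 / n ^ 2], and [2 / n < r] makes this less than [r ^ 2]. *)
rewrite distrC dE normc_def ltcR -(gtr0_norm r0) -sqrtr_sqr ltr_sqrt ?exprn_gt0//.
have n1 : 0 < n%:R^-1 :> R by rewrite invr_gt0.
rewrite !raddfB /=; nra.
Qed.

Theorem proposition4p7 (K : numFieldType) (hK : real_or_complex K)
    (X : completeNormedModType K) (x : X) (hx : unit_sphere x)
    (hsd : super_daugavet_point x) :
  forall (e : K), 0 < e ->
  forall W : set X, relatively_weakly_open_in_ball W -> W !=set0 ->
  exists2 y : X, W y &
    forall t : K, `|t| = 1 -> `|x + t *: y| > 2 - e.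
Proof.
(* Half of [e] is spent at the points of the net, the other half on replacing [t] by a net point
   [u], which costs at most [|t - u| * |y| <= |t - u|]. *)
move=> e e0 W oW W0; have e20 : 0 < e / 2 by rewrite divr_gt0// ltr0n.
have [s s1 s_net] := unit_circle_net hK e20.
have [y Wy xsy] := super_daugavet_norm_gt_seq hK hsd e20 s1 oW W0.
exists y => // t t1; have [u us tu] := s_net t t1.
have y1 : `|y| <= 1 by have [U _ WE] := oW; move: Wy; rewrite WE => -[].
rewrite [e]splitr opprD addrA ltrBlDr (lt_le_trans (xsy u us))//.
have -> : x + u *: y = x + t *: y - (t - u) *: y.
  by rewrite scalerBl opprB addrA addrAC addrK.
rewrite (le_trans (ler_normB _ _))// lerD2l normrZ.
by rewrite (le_trans (ler_piMr _ y1))// ltW.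
Qed.
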